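(* For every positive integer $m$, we have $$(-x)^m\sum_{0<n<p}\frac{T_n(x)}{(-m)^n}\equiv -x^p\sum_{l=0}^{m-1}\frac{(m-1)!}{l!}(-x)^l\pmod p$$ for any prime $p$ not dividing $m$, where $T_n(x)$ denotes the Touchard polynomial of degree $n$ and the congruence is between polynomials in $x$ with coefficients in $\mathbb{Z}_p$.
   Context: For nonnegative integers $n$ and $k$, the Stirling number of the second kind $S(n,k)$ is the number of ways to partition a set of $n$ elements into $k$ (nonempty) groups. The Touchard polynomial $T_n(x)$ of degree $n$ is $T_n(x)=\sum_{k=0}^n S(n,k)x^k$. For a prime $p$, $\mathbb{Z}_p$ denotes the ring of $p$-adic integers, and for two polynomials $P(x),Q(x)\in\mathbb{Z}_p[x]$, the notation $P(x)\equiv Q(x)\pmod p$ means that the corresponding coefficients of $P(x)$ and $Q(x)$ are congruent modulo $p$. Since $p\nmid m$, $1/(-m)^n$ is an element of $\mathbb{Z}_p$. *)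

(* Defs.v *)
From HB Require Import structures.
From mathcomp Require Import all_boot all_algebra.
From mathcomp Require Import boolp.

Set Implicit Arguments.
Unset Strict Implicit.
Unset Printing Implicit Defensive.

Import GRing.Theory.

Local Open Scope ring_scope.

Definition stirling2 (n k : nat) : nat :=
  #|[set P : {set {set 'I_n}} | partition P [set: 'I_n] & #|P| == k]|.

Definition touchard (R : nzRingType) (n : nat) : {poly R} :=
  \sum_(k < n.+1) (stirling2 n k)%:R *: 'X^k.

Lemma Zp_natr_mod (d e k : nat) :
  ((Zp_trunc d).+2 %| e)%N -> (k %% e)%:R = k%:R :> 'Z_d.
Proof.
move=> de; apply: val_inj; rewrite /= !Zp_nat /= modn_dvdm //.
Qed.

Lemma Zp_trunc_expn_dvd (p n : nat) :
  ((Zp_trunc (p ^ n.+1)).+2 %| (Zp_trunc (p ^ n.+2)).+2)%N.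
Proof.
have [p_gt1|p_le1] := ltnP 1 p.
  by rewrite !Zp_cast ?ltn_exp2l ?dvdn_exp2l // -{1}(expn0 p) ltn_exp2l.
by case: p p_le1 => [|[|//]] _; rewrite ?exp1n ?exp0n.
Qed.

(* The ring of p-adic integers, as the inverse limit of the rings Z/p^(n+1)Z:
   the component of index n is the residue modulo p^(n+1), and the canonical
   reduction Z/p^(n+2)Z -> Z/p^(n+1)Z sends a residue r to r%:R.
   This is the intended object for p > 1 only, because 'Z_0 and 'Z_1 are
   both 'I_2. *)
Record padic_int (p : nat) := PadicInt {
  residue :> forall n, 'Z_(p ^ n.+1);
  residue_coherent : forall n, (residue n.+1 : nat)%:R = residue n
}.

HB.instance Definition _ (p : nat) := gen_eqMixin (padic_int p).
HB.instance Definition _ (p : nat) := gen_choiceMixin (padic_int p).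

Section PadicRing.
Variable p : nat.
Implicit Types x y z : padic_int p.

Lemma padic_ext x y : (forall n, x n = y n) -> x = y.
Proof.
case: x y => [x hx] [y hy] /= xy.
have {}xy : x = y by apply: functional_extensionality_dep.
by case: y / xy hy => hy; congr PadicInt; apply: Prop_irrelevance.
Qed.

Fact padic_zero_coherent n : ((0%R : 'Z_(p ^ n.+2)) : nat)%:R = 0 :> 'Z_(p ^ n.+1).
Proof. by []. Qed.
Definition padic_zero := PadicInt padic_zero_coherent.

Fact padic_one_coherent n : ((1%R : 'Z_(p ^ n.+2)) : nat)%:R = 1 :> 'Z_(p ^ n.+1).
Proof. by []. Qed.
Definition padic_one := PadicInt padic_one_coherent.

Fact padic_add_coherent x y n : ((x n.+1 + y n.+1)%R : nat)%:R = x n + y n.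
Proof.
by rewrite Zp_natr_mod ?Zp_trunc_expn_dvd // natrD !residue_coherent.
Qed.
Definition padic_add x y := PadicInt (padic_add_coherent x y).

Fact padic_mul_coherent x y n : ((x n.+1 * y n.+1)%R : nat)%:R = x n * y n.
Proof.
by rewrite Zp_natr_mod ?Zp_trunc_expn_dvd // natrM !residue_coherent.
Qed.
Definition padic_mul x y := PadicInt (padic_mul_coherent x y).

Fact padic_opp_coherent x n : ((- x n.+1)%R : nat)%:R = - x n.
Proof.
apply/eqP; rewrite -addr_eq0 -[X in _ + X]residue_coherent -natrD.
rewrite -(Zp_natr_mod _ (Zp_trunc_expn_dvd p n)).
by have /(congr1 val) /= -> := addNr (x n.+1).
Qed.
Definition padic_opp x := PadicInt (padic_opp_coherent x).

Fact padic_addA : associative padic_add.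
Proof. by move=> x y z; apply: padic_ext => n; apply: addrA. Qed.
Fact padic_addC : commutative padic_add.
Proof. by move=> x y; apply: padic_ext => n; apply: addrC. Qed.
Fact padic_add0 : left_id padic_zero padic_add.
Proof. by move=> x; apply: padic_ext => n; apply: add0r. Qed.
Fact padic_addN : left_inverse padic_zero padic_opp padic_add.
Proof. by move=> x; apply: padic_ext => n; apply: addNr. Qed.

HB.instance Definition _ := GRing.isZmodule.Build (padic_int p)
  padic_addA padic_addC padic_add0 padic_addN.

Fact padic_mulA : associative padic_mul.
Proof. by move=> x y z; apply: padic_ext => n; apply: mulrA. Qed.
Fact padic_mulC : commutative padic_mul.
Proof. by move=> x y; apply: padic_ext => n; apply: mulrC. Qed.
Fact padic_mul1 : left_id padic_one padic_mul.
Proof. by move=> x; apply: padic_ext => n; apply: mul1r. Qed.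
Fact padic_mulD : left_distributive padic_mul padic_add.
Proof. by move=> x y z; apply: padic_ext => n; apply: mulrDl. Qed.
Fact padic_one_neq0 : padic_one != 0.
Proof.
by apply/eqP => /(congr1 (fun x : padic_int p => x 0%N)) /eqP; rewrite oner_eq0.
Qed.

HB.instance Definition _ := GRing.Zmodule_isComNzRing.Build (padic_int p)
  padic_mulA padic_mulC padic_mul1 padic_mulD padic_one_neq0.

Definition padic_unit : pred (padic_int p) :=
  fun x => `[< exists y : padic_int p, y * x = 1 >].
Definition padic_inv x : padic_int p :=
  if pselect (exists y : padic_int p, y * x = 1) is left h then projT1 (cid h)
  else x.

Fact padic_mulVx : {in padic_unit, left_inverse 1 padic_inv *%R}.
Proof.
move=> x /asboolP ux; rewrite /padic_inv.
by case: pselect => // h; case: cid.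
Qed.
Fact padic_unitP x y : y * x = 1 -> padic_unit x.
Proof. by move=> yx; apply/asboolP; exists y. Qed.
Fact padic_inv_out : {in [predC padic_unit], padic_inv =1 id}.
Proof.
by move=> x /asboolP nux; rewrite /padic_inv; case: pselect.
Qed.

HB.instance Definition _ := GRing.ComNzRing_hasMulInverse.Build (padic_int p)
  padic_mulVx padic_unitP padic_inv_out.

End PadicRing.

Definition polyp_congr (p : nat) (P Q : {poly padic_int p}) : Prop :=
  forall i : nat, exists c : padic_int p, P`_i - Q`_i = p%:R * c.

(* Main.v *)
Require Import Defs.
From HB Require Import structures.
From mathcomp Require Import all_boot all_algebra all_field.

(* Let L be the linear map on polynomials sending t^n to T_n(x). Splitting a
   partition according to the block of a fixed element gives
   L(t f(t)) = x L(f(t+1)), hence L((t)_k f(t)) = x^k L(f(t+k)), where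
   (t)_k = t(t-1)...(t-k+1). Over F_p the sum of the powers (t/(-m))^n for
   0 <= n < p is (t+m)^(p-1), and (t)_p = t^p - t, so
     x^m L((t+m)^(p-1) - 1) = L((t)_m (t^(p-1) - 1))
       = L((t)_p (t-1)...(t-m+1)) = x^p L((t-1)...(t-m+1)).
   The last factor follows from
   (t-1)...(t-k-1) = (t)_{k+1} - (k+1) (t-1)...(t-k) and L((t)_k) = x^k. *)

Import GRing.Theory.
Local Open Scope ring_scope.

(** * Stirling numbers of the second kind: recursion on the block of one element *)

Fixpoint stirling2_rec (n k : nat) : nat :=
  match k, n with
  | 0, 0 => 1
  | 0, _.+1 => 0
  | _.+1, 0 => 0
  | k'.+1, n'.+1 => \sum_(j < n'.+1) 'C(n', j) * stirling2_rec j k'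
  end%N.

Lemma sum_subset_card (T : finType) (D : {set T}) (g : nat -> nat) :
  (\sum_(C : {set T} | C \subset D) g #|C| =
   \sum_(j < #|D|.+1) 'C(#|D|, j) * g j)%N.
Proof.
(* Subsets are sorted by size; [inord] loses nothing, as a subset of [D] has at most [#|D|]
   elements. *)
rewrite (partition_big (fun C : {set T} => inord #|C| : 'I_(#|D|.+1)) xpredT) //=.
apply: eq_bigr => j _; rewrite -cards_draws -sum_nat_const.
have cardP (C : {set T}) : C \subset D ->
    (inord #|C| == j :> 'I_(#|D|.+1)) = (#|C| == j).
  by move=> CD; rewrite -val_eqE /= inordK // ltnS subset_leq_card.
apply: eq_big => [C|C /andP[CD]].
  by rewrite inE; case: (boolP (_ \subset _)) => // /cardP.
by rewrite cardP // => /eqP->.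
Qed.

(** The block of [x] is forced to be [B = D :\: C]. Adding [B] to a partition of [C] is injective,
    since [B] contains [x] and so is never a block of such a partition; removing [B] is the
    inverse. *)
Lemma card_partitions_block (T : finType) (D C : {set T}) (x : T) (k : nat) :
    x \in D -> C \subset D :\ x ->
  #|[set P : {set {set T}} | [&& partition P D, #|P| == k.+1
                               & D :\: pblock P x == C]]| =
  #|[set Q : {set {set T}} | partition Q C & #|Q| == k]|.
Proof.
move=> Dx /subsetD1P[CD Cx]; pose B := D :\: C.
have Bx : x \in B by rewrite inE Cx.
have B0 : B != set0 by apply/set0Pn; exists x.
have DB : D :\: B = C by rewrite setDDr setDv set0U (setIidPr CD).
have dBC : [disjoint B & C].
  by rewrite disjoints_subset /B setDE subsetIr.
have notBQ Q : partition Q C -> B \notin Q.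
  move=> pQ; apply/negP => /(partitionS pQ)/subsetP/(_ _ Bx).
  by rewrite (negbTE Cx).
rewrite -[RHS](card_in_imset (f := fun Q : {set {set T}} => B |: Q)); last first.
  move=> Q1 Q2; rewrite !inE => /andP[/notBQ Q1B _] /andP[/notBQ Q2B _] eqU.
  by rewrite -(setU1K Q1B) -(setU1K Q2B) eqU.
apply: eq_card => P; rewrite inE; apply/idP/imsetP.
  case/and3P => pP /eqP cP /eqP defC.
  have covx : x \in cover P by rewrite (cover_partition pP).
  have BE : pblock P x = B.
    rewrite /B -defC setDDr setDv set0U; apply/esym/setIidPr.
    by apply: partitionS pP _; apply: pblock_mem.
  have PB : B \in P by rewrite -BE pblock_mem.
  exists (P :\ B); last by rewrite setD1K.
  rewrite inE -DB partitionD1 //=.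
  by move: cP; rewrite (cardsD1 B) PB add1n => -[->].
case=> Q; rewrite inE => /andP[pQ /eqP cQ] ->.
have pU : partition (B |: Q) D.
  have -> : D = B :|: C by rewrite setUC -(setID D C) (setIidPr CD).
  exact: partitionU1.
rewrite pU cardsU1 notBQ // cQ add1n eqxx /=.
rewrite (def_pblock (partition_trivIset pU) _ Bx) ?DB //.
exact: setU11.
Qed.

Lemma card_partitions (T : finType) (D : {set T}) (k : nat) :
  #|[set P : {set {set T}} | partition P D & #|P| == k]| = stirling2_rec #|D| k.
Proof.
elim: k => [|k IHk] in D *.
  have [->|D0] := eqVneq D set0.
    rewrite cards0 /=; apply/eqP/cards1P; exists set0; apply/setP => P.
    by rewrite !inE partition_set0 cards_eq0 andbb.
  have: (0 < #|D|)%N by rewrite card_gt0.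
  case: #|D| => //= _ _; apply/eqP; rewrite cards_eq0; apply/eqP/setP => P.
  rewrite !inE cards_eq0 andbC; case: eqP => //= ->.
  by rewrite /partition /cover big_set0 eq_sym (negbTE D0).
have [->|[x Dx]] := set_0Vmem D.
  rewrite cards0 /=; apply/eqP; rewrite cards_eq0; apply/eqP/setP => P.
  by rewrite !inE partition_set0; case: eqP => //= ->; rewrite cards0.
rewrite (cardsD1 x) Dx add1n /= -(sum_subset_card _ _ (stirling2_rec ^~ k)).
rewrite -sum1_card.
(* Partitions are sorted by the complement [C] of the block of [x]; the summation index of
   [stirling2_rec] is the size of [C]. *)
rewrite (partition_big (fun P => D :\: pblock P x)
  (fun C => C \subset D :\ x)) /=.
  apply: eq_bigr => C CD; rewrite -IHk -(card_partitions_block _ _ _ _ _ Dx CD).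
  by rewrite -sum1_card; apply: eq_bigl => P; rewrite !inE andbA.
move=> P; rewrite inE => /andP[pP _]; apply/subsetD1P.
by rewrite subsetDl; split => //; rewrite inE mem_pblock (cover_partition pP) Dx.
Qed.

Lemma stirling2E (n k : nat) : stirling2 n k = stirling2_rec n k.
Proof. by rewrite /stirling2 card_partitions cardsT card_ord. Qed.

Lemma stirling2_small (n k : nat) : (n < k)%N -> stirling2 n k = 0%N.
Proof.
rewrite stirling2E; elim: k n => // k IHk [|n] //= nk.
by apply: big1 => j _; rewrite IHk ?muln0 // (leq_trans (ltn_ord j)).
Qed.

(** * Touchard polynomials and the umbral map *)

Lemma coef_touchard (R : nzRingType) (n k : nat) :
  (touchard R n)`_k = (stirling2 n k)%:R.
Proof.
rewrite /touchard -(poly_def n.+1 (fun k => (stirling2 n k)%:R)) coef_poly.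
by case: ltnP => // /stirling2_small ->.
Qed.

Lemma touchard0 (R : nzRingType) : touchard R 0 = 1.
Proof. by apply/polyP => -[|k]; rewrite coef_touchard stirling2E coefC. Qed.

Lemma touchardS (R : nzRingType) (n : nat) :
  touchard R n.+1 = 'X * \sum_(j < n.+1) touchard R j *+ 'C(n, j).
Proof.
apply/polyP => -[|k]; rewrite coef_touchard coefXM stirling2E //=.
rewrite natr_sum coef_sum; apply: eq_bigr => j _.
by rewrite coefMn coef_touchard natrM stirling2E mulr_natl.
Qed.

(** This is the map L of the overview; the same indeterminate ['X] plays t in the argument and x in
    the value. *)
Definition touchard_umbra (R : comNzRingType) (f : {poly R}) : {poly R} :=
  \sum_(i < size f) f`_i *: touchard R i.

(** Freeing the bound from the size of [f] lets several polynomials share one summation range, as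
    linearity requires. *)
Lemma touchard_umbraE (R : comNzRingType) (N : nat) (f : {poly R}) :
  (size f <= N)%N -> touchard_umbra R f = \sum_(i < N) f`_i *: touchard R i.
Proof.
move=> fN; rewrite /touchard_umbra.
rewrite (big_ord_widen _ (fun i => f`_i *: touchard R i) fN).
rewrite big_mkcond; apply: eq_bigr => i _; case: ltnP => // /(nth_default 0) ->.
by rewrite scale0r.
Qed.

Fact touchard_umbra_is_linear (R : comNzRingType) : linear (touchard_umbra R).
Proof.
move=> a f g; set N := maxn (size (a *: f + g)) (maxn (size f) (size g)).
rewrite !(@touchard_umbraE R N) ?leq_max ?leqnn ?orbT // scaler_sumr -big_split.
by apply: eq_bigr => i _; rewrite coefD coefZ scalerDl scalerA.
Qed.

HB.instance Definition _ (R : comNzRingType) :=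
  GRing.isLinear.Build R {poly R} {poly R} *:%R (touchard_umbra R)
    (touchard_umbra_is_linear R).

Lemma touchard_umbraXn (R : comNzRingType) (n : nat) :
  touchard_umbra R 'X^n = touchard R n.
Proof.
rewrite /touchard_umbra size_polyXn (bigD1 ord_max) //= coefXn eqxx scale1r.
rewrite big1 ?addr0 // => i /negPf ni; rewrite coefXn.
by rewrite -val_eqE /= in ni; rewrite ni scale0r.
Qed.

Lemma touchard_umbra1 (R : comNzRingType) : touchard_umbra R 1 = 1.
Proof. by rewrite -(expr0 'X) touchard_umbraXn touchard0. Qed.

(** By linearity [f] may be taken to be a power of ['X]; then [touchardS] is the binomial expansion
    of [('X + 1) ^+ i] under the map. *)
Lemma touchard_umbra_mulX (R : comNzRingType) (f : {poly R}) :
  touchard_umbra R ('X * f) = 'X * touchard_umbra R (f \Po ('X + 1)).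
Proof.
rewrite -[f]coefK poly_def mulr_sumr !linear_sum mulr_sumr.
apply: eq_bigr => i _; rewrite -scalerAr !linearZ /= -scalerAr; congr (_ *: _).
rewrite -exprS touchard_umbraXn touchardS comp_Xn_poly exprDn linear_sum /=.
(* [exprDn] lists the powers of ['X] in decreasing order, so the sum is reversed and the symmetry of
   binomial coefficients is used. *)
congr ('X * _); rewrite (reindex_inj rev_ord_inj) /=; apply: eq_bigr => j _.
rewrite expr1n mulr1 linearMn /= touchard_umbraXn subSS bin_sub //.
by rewrite -ltnS.
Qed.

(** * Falling factorials under the umbral map *)

Definition falling_poly (R : comNzRingType) (k : nat) : {poly R} :=
  \prod_(i < k) ('X - i%:R).

(** Induction peels off the last factor ['X - k%:R]: the shift by [k] turns it into ['X], to which
    [touchard_umbra_mulX] applies. *)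
Lemma touchard_umbra_falling (R : comNzRingType) (k : nat) (f : {poly R}) :
  touchard_umbra R (falling_poly R k * f) =
  'X^k * touchard_umbra R (f \Po ('X + k%:R)).
Proof.
elim: k f => [|k IHk] f.
  by rewrite /falling_poly big_ord0 !mul1r addr0 comp_polyXr.
rewrite /falling_poly big_ord_recr /= -mulrA IHk comp_polyM comp_polyB.
rewrite comp_polyX rmorph_nat addrK touchard_umbra_mulX mulrA -exprSr -comp_polyA.
by rewrite comp_polyD comp_polyX rmorph_nat -addrA -natr1 [_ + 1]addrC.
Qed.

Definition shifted_falling_poly (R : comNzRingType) (k : nat) : {poly R} :=
  \prod_(i < k) ('X - i.+1%:R).

Lemma falling_polyS (R : comNzRingType) (k : nat) :
  falling_poly R k.+1 = 'X * shifted_falling_poly R k.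
Proof. by rewrite /falling_poly big_ord_recl subr0. Qed.

Lemma touchard_umbra_shifted_falling (R : comNzRingType) (k : nat) :
  touchard_umbra R (shifted_falling_poly R k) =
  (-1) ^+ k * \sum_(l < k.+1) (k`! %/ l`!)%:R *: (- 'X) ^+ l.
Proof.
elim: k => [|k IHk].
  rewrite /shifted_falling_poly big_ord0 touchard_umbra1.
  by rewrite big_ord1 expr0 mul1r scale1r.
have -> : shifted_falling_poly R k.+1 =
    falling_poly R k.+1 * 1 - shifted_falling_poly R k *+ k.+1.
  rewrite falling_polyS mulr1 {1}/shifted_falling_poly big_ord_recr /=.
  by rewrite mulrBr mulr_natr mulrC.
rewrite linearB linearMn /= touchard_umbra_falling IHk rmorph1.
rewrite touchard_umbra1 mulr1.
(* The top term [l = k.+1] on the right is ['X^k.+1], the image of the falling factorial; the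
   remaining terms are [- k.+1] times the previous sum. *)
rewrite [in RHS]big_ord_recr /= divnn fact_gt0 scale1r mulrDr.
rewrite -exprMn mulN1r opprK addrC; congr (_ + _).
rewrite exprS mulN1r mulNr; congr (- _).
rewrite -mulrnAr -sumrMnl; congr (_ * _); apply: eq_bigr => l _.
rewrite -scaler_nat scalerA -natrM factS -muln_divA //.
(* Writing [k!] through a binomial coefficient shows that the division by [l!] is exact. *)
have /bin_fact <- : (l <= k)%N by rewrite -ltnS.
by rewrite mulnCA dvdn_mulr.
Qed.

(** * The identity over the field with p elements *)

Lemma exprpE (R : pzSemiRingType) (p : nat) (p_prime : prime p) (x : R) :
  x ^+ p = x * x ^+ p.-1.
Proof. by rewrite -exprS prednK ?prime_gt0. Qed.

(** The integers 0, ..., p-1 represent every element of ['F_p], and these are exactly the roots of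
    ['X^p - 'X]. *)
Lemma falling_poly_Fp (p : nat) (p_prime : prime p) :
  falling_poly 'F_p p = 'X^p - 'X.
Proof.
rewrite -[p in 'X^p]card_Fp // finField_genPoly /falling_poly.
rewrite -(big_mkord xpredT (fun i => 'X - i%:R : {poly 'F_p})).
have -> : index_iota 0 p = index_iota 0 (Zp_trunc (pdiv p)).+2.
  by rewrite Fp_cast.
rewrite big_mkord; apply: eq_bigr => i _.
by rewrite -[in RHS](natr_Zp i) polyC_natr.
Qed.

Lemma Fp_expX (p : nat) (p_prime : prime p) (a : 'F_p) :
  a != 0 -> a ^+ p.-1 = 1.
Proof.
move=> a0; apply: (mulfI a0); rewrite mulr1 -exprpE //.
by rewrite -[X in a ^+ X]card_Fp // expf_card.
Qed.

(* With u = - 'X / a, the sum over 0 <= n < p is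
   (u ^+ p - 1) / (u - 1) = (u - 1) ^+ p.-1. *)
Lemma Fp_geometric_sum (p : nat) (p_prime : prime p) (a : 'F_p) :
  a != 0 ->
  \sum_(1 <= n < p) ((- a) ^+ n)^-1 *: 'X^n = ('X + a%:P) ^+ p.-1 - 1.
Proof.
move=> a0; have na0 : (- a)^-1 != 0 by rewrite invr_eq0 oppr_eq0.
set u : {poly 'F_p} := (- a)^-1 *: 'X.
have uX n : u ^+ n = ((- a) ^+ n)^-1 *: 'X^n by rewrite exprZn exprVn.
have u1 : u - 1 = (- a)^-1 *: ('X + a%:P).
  rewrite scalerDr -[a%:P]alg_polyC scalerA -[a in _ * a]opprK mulrN.
  by rewrite mulVf ?oppr_eq0 // scaleN1r.
have u1_neq0 : u - 1 != 0.
  by rewrite u1 scaler_eq0 negb_or na0 -size_poly_eq0 size_XaddC.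
have geo : \sum_(i < p) u ^+ i = ('X + a%:P) ^+ p.-1.
  apply: (mulfI u1_neq0); rewrite -subrX1.
  transitivity ((u - 1) ^+ p).
    have pnat_p : [pchar {poly 'F_p}].-nat p.
      by rewrite pnatE // pchar_poly pchar_Fp.
    by rewrite exprDn_pchar // exprNn_pchar // expr1n.
  (* One factor [u - 1] is kept for cancellation; in the other p-1 the scalar [(- a)^-1] disappears
     by Fermat's little theorem. *)
  rewrite (exprpE _ _ p_prime) {2}u1 exprZn.
  by rewrite Fp_expX // scale1r.
rewrite -geo -(big_mkord xpredT (fun i => u ^+ i)) big_ltn ?prime_gt0 //.
by rewrite expr0 addrC addKr; apply: eq_bigr => n _; rewrite uX.
Qed.

Lemma touchard_sum_Fp (p : nat) (p_prime : prime p) (m : nat) :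
    (0 < m)%N -> ~~ (p %| m)%N ->
  (- 'X) ^+ m * \sum_(1 <= n < p) ((- m%:R) ^+ n)^-1 *: touchard 'F_p n =
  - ('X^p * \sum_(l < m) ((m.-1)`! %/ l`!)%:R *: (- 'X) ^+ l).
Proof.
case: m => // k _ pk; set a : 'F_p := k.+1%:R.
have a0 : a != 0 by rewrite -(dvdn_pcharf (pchar_Fp p_prime)).
pose h : {poly 'F_p} := 'X^(p.-1) - 1.
have hE : h \Po ('X + k.+1%:R) = \sum_(1 <= n < p) ((- a) ^+ n)^-1 *: 'X^n.
  rewrite Fp_geometric_sum // /h comp_polyB comp_Xn_poly.
  by rewrite rmorph1 /a polyC_natr.
have -> : \sum_(1 <= n < p) ((- a) ^+ n)^-1 *: touchard 'F_p n =
    touchard_umbra 'F_p (h \Po ('X + k.+1%:R)).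
  rewrite hE linear_sum; apply: eq_bigr => n _.
  by rewrite linearZ /= touchard_umbraXn.
rewrite exprNn -mulrA -touchard_umbra_falling.
have -> : falling_poly 'F_p k.+1 * h =
    falling_poly 'F_p p * shifted_falling_poly 'F_p k.
  rewrite falling_poly_Fp // falling_polyS /h (exprpE _ _ p_prime).
  by rewrite mulrAC mulrBr mulr1.
(* The shift by p is trivial in characteristic p, so extracting the falling factorial of length p
   only contributes ['X^p]. *)
rewrite touchard_umbra_falling -polyC_natr pchar_Fp_0 // addr0 comp_polyXr.
rewrite touchard_umbra_shifted_falling mulrCA [X in _ * X]mulrA -exprD.
(* With [m = k.+1], the signs from [(- 'X) ^+ m] and from the shifted falling factorial combine to
   the odd power [k.+1 + k] of -1. *)
rewrite addSn exprS addnn -mul2n exprM sqrrN !expr1n mulr1.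
by rewrite mulN1r mulrN.
Qed.

(** * Reduction of p-adic integers modulo p *)

Lemma Zp_trunc_pdiv_dvd (p : nat) :
  ((Zp_trunc (pdiv p)).+2 %| (Zp_trunc (p ^ 1)).+2)%N.
Proof.
have [p_gt1|] := ltnP 1 p; last by case: p => [|[]].
by rewrite expn1 !Zp_cast ?pdiv_dvd // prime_gt1 // pdiv_prime.
Qed.

(** The component of index 0 is the residue modulo p; the cast is needed because ['Z_(p ^ 1)] and
    ['F_p] are different types. The divisibility of moduli above holds for every [p], so the
    morphism instances do not depend on primality. *)
Definition padic_to_Fp (p : nat) (x : padic_int p) : 'F_p := (x 0%N : nat)%:R.

Fact padic_to_Fp_is_nmod_morphism (p : nat) : nmod_morphism (padic_to_Fp p).
Proof.
split=> [//|x y].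
by rewrite /padic_to_Fp /= Zp_natr_mod ?Zp_trunc_pdiv_dvd // natrD.
Qed.

HB.instance Definition _ (p : nat) :=
  GRing.isNmodMorphism.Build (padic_int p) 'F_p (padic_to_Fp p)
    (padic_to_Fp_is_nmod_morphism p).

Fact padic_to_Fp_is_monoid_morphism (p : nat) : monoid_morphism (padic_to_Fp p).
Proof.
split=> [//|x y].
by rewrite /padic_to_Fp /= Zp_natr_mod ?Zp_trunc_pdiv_dvd // natrM.
Qed.

HB.instance Definition _ (p : nat) :=
  GRing.isMonoidMorphism.Build (padic_int p) 'F_p (padic_to_Fp p)
    (padic_to_Fp_is_monoid_morphism p).

Lemma residue_natr (p k n : nat) : (k%:R : padic_int p) n = k%:R.
Proof. by elim: k => // k IHk; rewrite -!natr1 -IHk. Qed.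

Lemma residue_val (p : nat) (p_prime : prime p) (x : padic_int p) (n : nat) :
  x n = (x n.+1 %% p ^ n.+1)%N :> nat.
Proof.
by rewrite -(residue_coherent x n) val_Zp_nat // -(expn0 p) ltn_exp2l ?prime_gt1.
Qed.

Lemma Zp_natr_modn (q e k : nat) :
  (1 < q)%N -> (q %| e)%N -> (k %% e)%:R = k%:R :> 'Z_q.
Proof. by move=> q_gt1 qe; rewrite Zp_natr_mod // Zp_cast. Qed.

(** Coherence spreads divisibility by p from the first residue to all of them, so that [x] can be
    divided by p level by level. *)
Lemma padic_to_Fp_eq0 (p : nat) (p_prime : prime p) (x : padic_int p) :
  padic_to_Fp p x = 0 -> exists c : padic_int p, x = p%:R * c.
Proof.
move=> x0; have pn_gt1 n : (1 < p ^ n.+1)%N.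
  by rewrite -(expn0 p) ltn_exp2l ?prime_gt1.
have p_dvd n : (p %| x n)%N.
  elim: n => [|n IHn].
    by rewrite (dvdn_pcharf (pchar_Fp p_prime)); apply/eqP.
  by move: IHn; rewrite residue_val // /dvdn modn_dvdm // expnS dvdn_mulr.
(* Dividing by p loses one power of p, so the quotient modulo [p ^ n.+1] is read off the residue of
   [x] modulo [p ^ n.+2]. *)
pose c n : 'Z_(p ^ n.+1) := (x n.+1 %/ p)%:R.
have c_coherent n : (c n.+1 : nat)%:R = c n.
  rewrite /c val_Zp_nat // (residue_val _ _ x n.+1) //.
  rewrite Zp_natr_modn ?dvdn_exp2l //.
  by rewrite (expnSr p n.+1) -modn_divl Zp_natr_modn.
exists (PadicInt c_coherent); apply: padic_ext => n.
change (x n = (p%:R : padic_int p) n * c n).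
by rewrite residue_natr -natrM mulnC divnK // residue_coherent.
Qed.

(** An integer prime to p is invertible modulo every power of p, and uniqueness of inverses makes
    the family of inverses coherent. *)
Lemma padic_natr_unit (p : nat) (p_prime : prime p) (m : nat) :
  ~~ (p %| m)%N -> (m%:R : padic_int p) \is a GRing.unit.
Proof.
move=> pm; have pn_gt1 n : (1 < p ^ n.+1)%N.
  by rewrite -(expn0 p) ltn_exp2l ?prime_gt1.
have m_unit n : (m%:R : 'Z_(p ^ n.+1)) \is a GRing.unit.
  by rewrite unitZpE // coprimeXl // prime_coprime.
pose y n : 'Z_(p ^ n.+1) := m%:R^-1.
have y_coherent n : (y n.+1 : nat)%:R = y n.
  apply: (mulrI (m_unit n)); rewrite divrr ?m_unit // -natrM.
  rewrite -(Zp_natr_modn _ (p ^ n.+2)) ?dvdn_exp2l //.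
  have : (m * y n.+1)%:R = 1 :> 'Z_(p ^ n.+2).
    by rewrite natrM natr_Zp divrr ?m_unit.
  move=> /(congr1 val) /=.
  by rewrite val_Zp_nat // => ->.
apply/unitrP; exists (PadicInt y_coherent).
have yK : PadicInt y_coherent * m%:R = 1.
  apply: padic_ext => n; change (y n * (m%:R : padic_int p) n = 1).
  by rewrite residue_natr mulVr ?m_unit.
by split; rewrite // mulrC.
Qed.

(** * Transfer of the identity to polynomials over the p-adic integers *)

Lemma polyp_congr_map_poly (p : nat) (p_prime : prime p)
    (P Q : {poly padic_int p}) :
  map_poly (padic_to_Fp p) P = map_poly (padic_to_Fp p) Q -> polyp_congr P Q.
Proof.
move=> PQ i; apply: padic_to_Fp_eq0 => //.
have /= := congr1 (coefp i) PQ; rewrite !coef_map rmorphB /= => ->.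
by rewrite subrr.
Qed.

Lemma map_touchard (R S : nzRingType) (f : {rmorphism R -> S}) (n : nat) :
  map_poly f (touchard R n) = touchard S n.
Proof. by apply/polyP => k; rewrite coef_map !coef_touchard /= rmorph_nat. Qed.

Theorem theorem2 (m : nat) (m_gt0 : (0 < m)%N) (p : nat) (p_prime : prime p)
    (p_ndiv_m : ~~ (p %| m)%N) :
  polyp_congr (p := p)
    ((- 'X) ^+ m *
       \sum_(1 <= n < p) ((- m%:R) ^+ n)^-1 *: touchard (padic_int p) n)
    (- ('X^p * \sum_(l < m) (((m.-1)`! %/ l`!)%N)%:R *: (- 'X) ^+ l)).
Proof.
apply: polyp_congr_map_poly => //.
(* Reduction is known to commute with inversion only at units, so [rmorphV] below needs the powers
   of [- m%:R] to be units. *)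
have m_unit := padic_natr_unit _ p_prime _ p_ndiv_m.
rewrite rmorphN !rmorphM !rmorph_sum !rmorphXn rmorphN /= map_polyX.
under eq_bigr => n _.
  rewrite map_polyZ map_touchard rmorphV ?unitrX ?unitrN //=.
  rewrite rmorphXn rmorphN rmorph_nat.
  over.
rewrite touchard_sum_Fp //; congr (- (_ * _)).
apply: eq_bigr => l _.
by rewrite map_polyZ rmorphXn rmorphN /= map_polyX rmorph_nat.
Qed.
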